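(* For each integer $n\ge 2$ let $m=m(n)$ be an integer with $1\le m\le n/2$ and $m\in[n/4,\,n/4+1]$. Then, with $\dim_H$ denoting Hausdorff dimension, $$\lim_{\substack{n\to\infty\\ n\text{ even}}}\dim_H F_{\{n/m\}}[L^0,0]=2\qquad\text{and}\qquad \lim_{\substack{n\to\infty\\ n\text{ odd}}}\dim_H F_{\{n/m\}}[L^1,\gamma(n,m,1)]=2 .$$
   Context: Identify the plane with $\mathbb{C}$. For integers $n\ge 2$ and $1\le m\le n/2$ put $$P=P(n,m)=\frac{\sin(\pi/n)}{2\cos\big((m-1)\pi/n\big)\,\sin(m\pi/n)}.$$ Let $a_k=e^{2\pi i k/n}$ and $S_k(z)=P z+(1-P)a_k$ for $k=1,\dots,n$. For an integer $l$ with $0\le l\le n$ and $l\equiv n \pmod 2$ put $$P_c(n,m,l)=\sqrt{2P(P-1)\big(1+\cos(l\pi/n)\big)+1},$$ $$\gamma(n,m,l)=\arctan\left(\frac{P\sin(l\pi/n)}{1-P-P\cos(l\pi/n)}\right).$$ For an angle $\theta$, define the central map $S_c(z)=P_c(n,m,l)\,e^{i\theta}z$. Then $F_{\{n/m\}}[L^l,\theta]$ denotes the attractor of the iterated function system $\{S_1,\dots,S_n,S_c\}$, i.e. the unique nonempty compact set $F$ with $F=S_c(F)\cup\bigcup_{k=1}^n S_k(F)$. Thus $F_{\{n/m\}}[L^0,0]$ (for $n$ even) uses $l=0$ and no rotation, and $F_{\{n/m\}}[L^1,\gamma(n,m,1)]$ (for $n$ odd) uses $l=1$ and rotation angle $\theta=\gamma(n,m,1)$.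 *)

(* Defs.v *)
From HB Require Import structures.
From mathcomp Require Import all_boot all_order all_algebra.
From mathcomp Require Import complex.
From mathcomp Require Import all_classical all_reals all_analysis.
Set Implicit Arguments.
Unset Strict Implicit.
Unset Printing Implicit Defensive.
Import Order.TTheory GRing.Theory Num.Theory.
Import numFieldNormedType.Exports.
Local Open Scope classical_set_scope.
Local Open Scope ring_scope.
Local Open Scope complex_scope.

Section hausdorff_dimension.
Context {R : realType}.
Local Open Scope ereal_scope.

(* Normc.normc is the R-valued modulus; `|z| is the R[i]-valued one.
   Adding 0 to the family only matters for U = set0, whose diameter is 0. *)
Definition diam (U : set R[i]) : \bar R :=
  ereal_sup (0 |` [set (Normc.normc (p.1 - p.2)%R)%:E | p in U `*` U]).

(* diam(U)^s, with the usual conventions diam(set0)^0 = 0 and diam([set x])^0 = 1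
   (poweR x 0 = 1 for every x). *)
Definition diam_pow (s : R) (U : set R[i]) : \bar R :=
  if U == set0 then 0 else diam U `^ s.

(* Countable covers are indexed by nat; finite ones are padded with set0. *)
Definition hausdorff_premeasure (s delta : R) (A : set R[i]) : \bar R :=
  ereal_inf [set \sum_(k <oo) diam_pow s (U k) |
    U in [set U : (set R[i])^nat |
      A `<=` \bigcup_k U k /\ forall k, diam (U k) <= delta%:E]].

Definition hausdorff_measure (s : R) (A : set R[i]) : \bar R :=
  ereal_sup [set hausdorff_premeasure s delta A |
    delta in [set delta : R | (0 < delta)%R]].

Definition hausdorff_dim (A : set R[i]) : \bar R :=
  ereal_inf [set s%:E |
    s in [set s : R | (0 <= s)%R /\ hausdorff_measure s A = 0]].

End hausdorff_dimension.

Section attractor.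
Context {R : realType}.

(* R[i] itself carries no topology; R[i]^o is the same type with the topology
   of the modulus, that is, the usual topology of the plane. *)
Definition is_attractor (I : set (R[i] -> R[i])) (F : set R[i]) : Prop :=
  [/\ F !=set0, compact (F : set R[i]^o) & F = \bigcup_(f in I) (f @` F)].

(* The set F such that is_attractor I F; set0 is a junk value, taken only when
   there is no such F. For a finite family I of contractions, F exists and is
   unique. *)
Definition attractor (I : set (R[i] -> R[i])) : set R[i] :=
  xget set0 [set F | is_attractor I F].

End attractor.

Section polygonal_fractals.
Context {R : realType}.

Definition cis (t : R) : R[i] := cos t +i* sin t.

Definition vertex_ratio (n m : nat) : R :=
  sin (pi / n%:R) /
  (2 * cos ((m%:R - 1) * pi / n%:R) * sin (m%:R * pi / n%:R)).

Definition vertex (n k : nat) : R[i] := cis (2 * pi * k%:R / n%:R).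

Definition vertex_map (n m k : nat) (z : R[i]) : R[i] :=
  (vertex_ratio n m)%:C * z + (1 - vertex_ratio n m)%:C * vertex n k.

Definition central_ratio (n m l : nat) : R :=
  Num.sqrt (2 * vertex_ratio n m * (vertex_ratio n m - 1) *
            (1 + cos (l%:R * pi / n%:R)) + 1).

Definition gamma_angle (n m l : nat) : R :=
  atan (vertex_ratio n m * sin (l%:R * pi / n%:R) /
        (1 - vertex_ratio n m - vertex_ratio n m * cos (l%:R * pi / n%:R))).

Definition central_map (n m l : nat) (theta : R) (z : R[i]) : R[i] :=
  (central_ratio n m l)%:C * cis theta * z.

(* F_{n/m}[L^l, theta] *)
Definition polygonal_fractal (n m l : nat) (theta : R) : set R[i] :=
  attractor ([set vertex_map n m k | k in [set k | (1 <= k <= n)%N]]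
             `|` [set central_map n m l theta]).

End polygonal_fractals.

(* Main.v *)
Require Import Defs.
From mathcomp Require Import all_boot all_order all_algebra.
From mathcomp Require Import complex.
From mathcomp Require Import all_classical all_reals all_analysis.
From mathcomp Require Import finmap ring lra.
Set Implicit Arguments.
Unset Strict Implicit.
Unset Printing Implicit Defensive.
Import Order.TTheory GRing.Theory Num.Theory.
Import numFieldNormedType.Exports.
Local Open Scope classical_set_scope.
Local Open Scope ring_scope.

(* Upper bound: the fractal lies in the unit disk, which is covered by M^2 grid
   cells of diameter O(1/M).
   Lower bound: the images of the unit disk under the S_k form a ring of about n
   nearly tangent disks of radius P ~ pi/n, and the powers of S_c carry this ring
   to concentric rings filling the disk. Taking every second disk in every second
   one of the first ~ n/32 rings gives N >= const n^2 separated copies of the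
   fractal, with ratios r >= 1/(4n), so that N r^s >= 1 for large n as soon as
   s < 2. Separated copies with N r^s >= 1 force every finite cover to have
   s-dimensional sum at least (gap)^s, by induction on the number of members of
   the cover. Rotations preserve the rings, so the angle of S_c plays no role and
   the two parities are the same argument. *)

Local Open Scope complex_scope.
Import Normc.

(** * The real-valued modulus on the plane *)

Section modulus.
Context {R : realType}.
Implicit Types z w : R[i].

Lemma normc_opp z : normc (- z) = normc z.
Proof. exact: normcN. Qed.

Lemma normcB_sym z w : normc (z - w) = normc (w - z).
Proof. by rewrite -opprB normc_opp. Qed.

Lemma normcD_le z w : normc (z + w) <= normc z + normc w.
Proof. exact: le_normcD. Qed.

Lemma normc_tri z w u : normc (z - u) <= normc (z - w) + normc (w - u).
Proof. by rewrite -[z - u](subrKA w) normcD_le. Qed.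

Lemma normcB_ge z w : normc z - normc w <= normc (z - w).
Proof. by rewrite lerBlDr -[leLHS]/(normc z) -{1}(subrK w z) normcD_le. Qed.

Lemma normc_ge0 z : 0 <= normc z.
Proof. by case: z => a b; exact: sqrtr_ge0. Qed.

Lemma normcR (x : R) : normc x%:C = `|x|.
Proof. by rewrite /normc/= expr0n/= addr0 sqrtr_sqr. Qed.

Lemma normcX z k : normc (z ^+ k) = normc z ^+ k.
Proof.
elim: k => [|k IH]; first by rewrite !expr0 normc1.
by rewrite !exprS normcM IH.
Qed.

Lemma normc_cis (t : R) : normc (cis t) = 1.
Proof. by rewrite /normc /cis cos2Dsin2 sqrtr1. Qed.

Lemma normcE_C z : `|z| = (normc z)%:C.
Proof. by []. Qed.

Lemma normc_leDReIm z : normc z <= `|complex.Re z| + `|complex.Im z|.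
Proof.
case: z => a b /=; rewrite -[leRHS]ger0_norm ?addr_ge0// -sqrtr_sqr.
rewrite ler_wsqrtr// sqrrD !real_normK ?num_real// lerD2r lerDl.
by rewrite mulrn_wge0// mulr_ge0.
Qed.

Lemma normc_geIm z : `|complex.Im z| <= normc z.
Proof. by case: z => a b /=; rewrite -sqrtr_sqr ler_wsqrtr// lerDr sqr_ge0. Qed.

Lemma normc_geRe z : `|complex.Re z| <= normc z.
Proof. by case: z => a b /=; rewrite -sqrtr_sqr ler_wsqrtr// lerDl sqr_ge0. Qed.

End modulus.

(** * Finite covers of a set containing separated similar copies of itself *)

Section lower_bound.
Context {R : realType}.
Variables (I : finType) (f : I -> R[i] -> R[i]) (rho : I -> R) (r delta t : R).
Variable F : set R[i].
Hypothesis f_sim : forall i z w, normc (f i z - f i w) = rho i * normc (z - w).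
Hypothesis r_gt0 : 0 < r.
Hypothesis rho_ge : forall i, r <= rho i.
Hypothesis I_gt1 : (1 < #|I|)%N.
Hypothesis F0 : F !=set0.
Hypothesis fF : forall i, f i @` F `<=` F.
Hypothesis delta_gt0 : 0 < delta.
Hypothesis f_sep : forall i j, i != j ->
  forall z w, F z -> F w -> delta <= normc (f i z - f j w).
Hypothesis t_ge0 : 0 <= t.
Hypothesis moran : 1 <= #|I|%:R * r `^ t.

(* If every member of the cover is smaller than the gap between the pieces, it
   meets at most one piece; pulling the members that meet the i-th piece back by
   f i covers F with fewer sets. *)
Lemma finite_cover_sum (D : seq nat) (U : nat -> set R[i]) (d : nat -> R) :
  (forall k, 0 <= d k) ->
  (forall k z w, U k z -> U k w -> normc (z - w) <= d k) ->
  (forall z, F z -> exists2 k, k \in D & U k z) ->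
  delta `^ t <= \sum_(k <- D) d k `^ t.
Proof.
have [N leN] := ubnP (size D).
elim: N => // N IH in D U d leN *.
move=> d0 dU FD.
(* A single member of size at least [delta] already pays for the whole bound; otherwise every member
   is smaller than the gap. *)
have [[k kD ddk]|small] := pselect (exists2 k, k \in D & delta <= d k).
  apply: (@le_trans _ _ (d k `^ t)).
    by rewrite ge0_ler_powR ?nnegrE// ltW.
  by rewrite (big_rem k)//= lerDl sumr_ge0// => j _; exact: powR_ge0.
have {}small k : k \in D -> d k < delta.
  by move=> kD; rewrite ltNge; apply/negP => h; apply: small; exists k.
pose meets i k := `[< exists2 z, F z & U k (f i z) >].
have meets_uniq k i j : k \in D -> meets i k -> meets j k -> i = j.
  move=> kD /asboolP[z Fz Uz] /asboolP[w Fw Uw].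
  apply/eqP; apply: contraT => ij.
  have := lt_le_trans (small _ kD) (f_sep ij Fz Fw).
  by move/lt_geF; rewrite dU.
pose D' i := [seq k <- D | meets i k].
have rho_gt0 i : 0 < rho i by exact: lt_le_trans (rho_ge i).
(* With at least two maps there is a piece [j != i]. A member of the cover that meets piece [j]
   misses piece [i], so [D' i] is strictly shorter than [D] and the induction applies. *)
have sizeD' i : (size (D' i) < N)%N.
  apply: (@leq_trans (size D)); last by rewrite -ltnS.
  have [j ji] : exists j, j != i.
    apply/existsP; rewrite -negb_forall; apply/negP => /forallP h.
    have := I_gt1; rewrite ltnNge => /negP; apply.
    apply/fintype_le1P => j k.
    by move: (h j) (h k) => /eqP-> /eqP->.
  have [z Fz] := F0.
  have [k kD Uk] := FD _ (fF (imageP (f j) Fz)).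
  rewrite size_filter ltn_neqAle count_size andbT.
  rewrite -all_count; apply/negP => /allP/(_ _ kD) ik.
  have jk : meets j k by apply/asboolP; exists z.
  by have /eqP := meets_uniq _ _ _ kD jk ik; rewrite (negbTE ji).
have stepi i : r `^ t * delta `^ t <= \sum_(k <- D' i) d k `^ t.
  have h : delta `^ t <= \sum_(k <- D' i) (d k / rho i) `^ t.
    apply: (@IH _ (fun k => f i @^-1` U k)) => //.
    - by move=> k; rewrite divr_ge0// ltW.
    - by move=> k z w /= Uz Uw; rewrite ler_pdivlMr// mulrC -f_sim dU.
    - move=> z Fz; have [k kD Uk] := FD _ (fF (imageP (f i) Fz)).
      by exists k => //; rewrite mem_filter kD andbT; apply/asboolP; exists z.
  apply: (@le_trans _ _ (rho i `^ t * \sum_(k <- D' i) (d k / rho i) `^ t)).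
    apply: ler_pM; rewrite ?powR_ge0//.
    by rewrite ge0_ler_powR// ?nnegrE ltW.
  rewrite mulr_sumr le_eqVlt; apply/orP; left; apply/eqP/eq_bigr => k _.
  rewrite -powRM ?divr_ge0// ?(ltW (rho_gt0 i))//.
  by rewrite mulrC divfK// gt_eqF.
(* The hypothesis [moran] makes the [#|I|] bounds add up to at least [delta ^ t], and by
   [meets_uniq] each member of [D] is counted for at most one piece. *)
apply: (@le_trans _ _ (\sum_(i : I) \sum_(k <- D' i) d k `^ t)).
  apply: (@le_trans _ _ (\sum_(i : I) r `^ t * delta `^ t)).
    rewrite sumr_const -mulr_natl mulrA ler_peMl ?powR_ge0//.
  by apply: ler_sum => i _.
under eq_bigr do rewrite big_filter big_mkcond/=.
rewrite exchange_big/= big_seq [leRHS]big_seq; apply: ler_sum => k kD.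
rewrite -big_mkcond/=.
have [[i ik]|no] := pselect (exists i, meets i k).
  rewrite (big_pred1 i)// => j; apply/idP/eqP => [jk|->//].
  exact: meets_uniq kD jk ik.
rewrite big_pred0 ?powR_ge0// => i; apply/negP => ik; apply: no; by exists i.
Qed.

End lower_bound.

(** * From countable covers to finite ones *)

Section covers.
Context {R : realType}.
Implicit Types (A U : set R[i]).

Lemma diam_ge0 U : (0 <= diam U)%E.
Proof. by apply: ereal_sup_ubound; left. Qed.

Lemma diam_pow_ge0 (s : R) U : (0 <= diam_pow s U)%E.
Proof. by rewrite /diam_pow; case: ifP => // _; exact: poweR_ge0. Qed.

Lemma le_diam U z w : U z -> U w -> ((normc (z - w))%:E <= diam U)%E.
Proof. by move=> Uz Uw; apply: ereal_sup_ubound; right; exists (z, w). Qed.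

Lemma diam_le U (d : R) : 0 <= d ->
  (forall z w, U z -> U w -> normc (z - w) <= d) -> (diam U <= d%:E)%E.
Proof.
move=> d0 Ud; apply: ge_ereal_sup => _ [->|[[z w] [/= Uz Uw] <-]].
  by rewrite lee_fin.
by rewrite lee_fin Ud.
Qed.

(* Compactness and a small enlargement of the members of a countable cover
   reduce the premeasure to finite covers. *)
Lemma hausdorff_premeasure_ge A (c t : R) : 0 <= t -> compact (A : set R[i]^o) ->
  (forall (D : seq nat) (U : nat -> set R[i]) (d : nat -> R),
    (forall k, 0 <= d k) ->
    (forall k z w, U k z -> U k w -> normc (z - w) <= d k) ->
    (forall z, A z -> exists2 k, k \in D & U k z) ->
    c <= \sum_(k <- D) d k `^ t) ->
  (c%:E <= hausdorff_premeasure t 1 A)%E.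
Proof.
move=> t0 Acpt finite_cover.
apply: le_ereal_inf_tmp => _ [U [AU diamU] <-].
have diam_fin k : diam (U k) \is a fin_num.
  by rewrite ge0_fin_numE ?diam_ge0// (le_lt_trans (diamU k)) ?ltry.
have fd_ge0 k : 0 <= fine (diam (U k)) by rewrite fine_ge0 ?diam_ge0.
apply/lee_addgt0Pr => e e0.
(* The enlargement of the [k]-th member may cost at most [e / 2 ^ k.+1], which sums to [e]. Empty
   members are excluded: for [t = 0] their enlargement would cost 1 instead of 0. *)
have slack k : exists eta : R, 0 < eta /\ (U k !=set0 ->
    (((fine (diam (U k)) + 2 * eta) `^ t)%:E <=
      diam_pow t (U k) + (e / (2 ^ k.+1)%:R)%:E)%E).
  set a := fine _; set b := e / _.
  have b0 : 0 < b by rewrite divr_gt0// ltr0n expn_gt0.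
  have [U0|Un0] := pselect (U k = set0).
    by exists 1; split => //; rewrite U0 => -[].
  have dp : diam_pow t (U k) = (a `^ t)%:E.
    rewrite /diam_pow ifF; last exact/negbTE/eqP.
    by rewrite -(fineK (diam_fin k)) poweR_EFin.
  move: t0; rewrite le_eqVlt => /predU1P[t0|t0].
    exists 1; split => // _; rewrite dp -t0 !powRr0 -EFinD lee_fin lerDl ltW//.
  (* This is the solution of [(a + 2 * eta) ^ t = a ^ t + b]. *)
  exists (((a `^ t + b) `^ t^-1 - a) / 2).
  have at0 : 0 <= a `^ t + b by rewrite addr_ge0 ?powR_ge0 ?ltW.
  rewrite divr_gt0// ?subr_gt0.
    split=> // _; rewrite dp -EFinD lee_fin mulrCA divff// mulr1 addrC subrK.
    by rewrite -powRrM mulVf ?gt_eqF// powRr1.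
  rewrite ltNge; apply/negP => h.
  have : ((a `^ t + b) `^ t^-1) `^ t <= a `^ t.
    apply: ge0_ler_powR; rewrite ?nnegrE ?powR_ge0//; first exact: ltW.
    exact: fd_ge0.
  by rewrite -powRrM mulVf ?gt_eqF// powRr1// gerDl leNgt b0.
have {slack}[eta slack] := choice slack.
have eta_gt0 k : 0 < eta k by have [] := slack k.
pose d k := fine (diam (U k)) + 2 * eta k.
pose V k : set R[i]^o := \bigcup_(x in U k) ball (x : R[i]^o) (eta k)%:C.
(* Only indices of nonempty members enter the open cover, so [slack] applies to every index selected
   by compactness. *)
move: Acpt; rewrite compact_cover => /(_ nat [set k | U k !=set0] V) [].
- by move=> k _; apply: bigcup_open => z _; exact: ball_open.
- move=> z /AU[k _ Ukz]; exists k; first by exists z.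
  by exists z => //; apply: ballxx; rewrite ltcR.
move=> D Dne AD.
apply: (@le_trans _ _ (\sum_(k <- enum_fset D) (d k `^ t)%:E)%E).
  rewrite sumEFin lee_fin.
  apply: (finite_cover (enum_fset D) V).
  - by move=> k; rewrite addr_ge0// mulr_ge0// ltW.
  - move=> k z w [x Ux xz] [y Uy yw].
    have {}xz : normc (x - z) < eta k by rewrite -ltcR.
    have {}yw : normc (y - w) < eta k by rewrite -ltcR.
    have xy : normc (x - y) <= fine (diam (U k)).
      by rewrite -lee_fin fineK// le_diam.
    have := normc_tri z x w; have := normc_tri x y w.
    by rewrite /d (normcB_sym z x); lra.
  - by move=> z /AD[k /= kD Vz]; exists k.
apply: (@le_trans _ _
    (\sum_(0 <= k <oo) (diam_pow t (U k) + (e / (2 ^ k.+1)%:R)%:E))%E).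
  apply: (@le_trans _ _
      (\sum_(k <- enum_fset D) (diam_pow t (U k) + (e / (2 ^ k.+1)%:R)%:E))%E).
    rewrite big_seq [leRHS]big_seq; apply: lee_sum => k kD.
    by have [_] := slack k; apply; exact/set_mem/Dne.
  apply: (lee_sum_fset_lim _ xpredT) => k _.
  by rewrite adde_ge0 ?diam_pow_ge0// lee_fin divr_ge0// ltW.
by apply: epsilon_trick => [k|]; [exact: diam_pow_ge0|exact: ltW].
Qed.

End covers.

(** * Bounds on the Hausdorff dimension *)

Section dimension.
Context {R : realType}.
Implicit Types (A : set R[i]).

(** The measure is a supremum over scales, so positivity of the premeasure at the single scale 1
    rules out the exponent [t]. *)
Lemma hausdorff_dim_ge A (s : R) :
  (forall t, 0 <= t -> t < s ->
    exists2 c, 0 < c & (c%:E <= hausdorff_premeasure t 1 A)%E) ->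
  (s%:E <= hausdorff_dim A)%E.
Proof.
move=> pos; apply: le_ereal_inf_tmp => _ [t [t0 At] <-].
rewrite lee_fin leNgt; apply/negP => /(pos _ t0)[c c0 cA].
have : (c%:E <= hausdorff_measure t A)%E.
  by apply: (le_trans cA); apply: ereal_sup_ubound; exists 1 => /=.
by rewrite At lee_fin leNgt c0.
Qed.

(** The index [k] encodes a pair of coordinates by division by [M]. The half-open cells of side
    [3 / M] tile [[-1, 2)^2]; a side of 3 instead of 2 keeps the coordinate 1 inside the tiling. *)
Definition grid_cell (M : nat) (k : nat) : set R[i] :=
  if (k < M * M)%N then
    [set z | (k %/ M)%:R <= (complex.Re z + 1) * M%:R / 3 < (k %/ M).+1%:R /\
             (k %% M)%:R <= (complex.Im z + 1) * M%:R / 3 < (k %% M).+1%:R]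
  else set0.

Lemma diam_grid_cell M k : (diam (grid_cell M k) <= (6 / M%:R)%:E)%E.
Proof.
apply: diam_le; first by rewrite divr_ge0.
move=> z w; rewrite /grid_cell; case: ifPn => // kM.
have M0 : (0 < M)%N by case: M kM.
have MR0 : 0 < M%:R :> R by rewrite ltr0n.
move=> [/andP[a1 a2] /andP[b1 b2]] [/andP[c1 c2] /andP[d1 d2]].
apply: (le_trans (normc_leDReIm _)).
rewrite ler_pdivlMr// mulrDl -{1 2}(gtr0_norm MR0) -!normrM.
have -> : complex.Re (z - w) = complex.Re z - complex.Re w.
  by case: z {a1 a2 b1 b2}; case: w {c1 c2 d1 d2}.
have -> : complex.Im (z - w) = complex.Im z - complex.Im w.
  by case: z {a1 a2 b1 b2}; case: w {c1 c2 d1 d2}.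
move: a1 a2 b1 b2 c1 c2 d1 d2; rewrite -!(natr1 (k %/ M)) -!(natr1 (k %% M)).
set i := (k %/ M)%:R; set j := (k %% M)%:R => a1 a2 b1 b2 c1 c2 d1 d2.
have h1 : `|(complex.Re z - complex.Re w) * M%:R| <= 3.
  by rewrite ler_norml; apply/andP; split; lra.
have h2 : `|(complex.Im z - complex.Im w) * M%:R| <= 3.
  by rewrite ler_norml; apply/andP; split; lra.
by lra.
Qed.

Lemma grid_cell_cover M : (0 < M)%N ->
  [set z | normc z <= 1] `<=` \bigcup_k grid_cell M k.
Proof.
move=> M0 z /= z1.
have MR0 : 0 < M%:R :> R by rewrite ltr0n.
have := le_trans (normc_geRe z) z1; have := le_trans (normc_geIm z) z1.
rewrite !ler_norml => /andP[y1 y2] /andP[x1 x2].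
have cell (x : R) : -1 <= x -> x <= 1 -> exists2 i, (i < M)%N &
    i%:R <= (x + 1) * M%:R / 3 < i.+1%:R.
  move=> x1' x2'.
  have g0 : 0 <= (x + 1) * M%:R / 3 by rewrite divr_ge0// mulr_ge0//; lra.
  exists (Num.truncn ((x + 1) * M%:R / 3)); last exact: truncn_itv.
  rewrite truncn_lt_nat// ltr_pdivrMr// mulrC ltr_pM2l//; lra.
have [i iM hi] := cell _ x1 x2; have [j jM hj] := cell _ y1 y2.
exists (i * M + j)%N => //; rewrite /grid_cell.
have -> : (i * M + j < M * M)%N.
  by rewrite (@leq_trans (i.+1 * M))// ?leq_mul2r ?iM ?orbT// mulSn addnC ltn_add2r.
by rewrite /= divnMDl// divn_small// addn0 modnMDl modn_small.
Qed.

(** At exponent [2 + e] the [M * M] cells cost at most [M ^ 2 (6 / M) ^ (2 + e) = 36 (6 / M) ^ e],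
    which tends to 0. *)
Lemma hausdorff_dim_le2 A : A `<=` [set z | normc z <= 1] ->
  (hausdorff_dim A <= 2%:E)%E.
Proof.
move=> A1; apply/lee_addgt0Pr => e e0; apply: ereal_inf_lbound.
exists (2 + e) => //; split; first by rewrite addr_ge0// ltW.
apply/eqP; rewrite eq_le; apply/andP; split; last first.
  apply: le_ereal_sup_tmp.
  exists (hausdorff_premeasure (2 + e) 1 A); first by exists 1 => /=.
  apply: le_ereal_inf_tmp => _ [U _ <-].
  by apply: nneseries_ge0 => k _ _; exact: diam_pow_ge0.
apply: ge_ereal_sup => _ [delta /= d0 <-].
apply/lee_addgt0Pr => eps eps0; rewrite add0e.
(* A cell diameter below [b] respects the scale [delta] and also makes [36 * b ^ e] at most
   [eps]. *)
pose b := Num.min delta ((eps / 36) `^ e^-1).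
have b0 : 0 < b by rewrite lt_min d0 powR_gt0 ?divr_gt0.
pose M := (Num.truncn (6 / b)).+1.
have MR0 : 0 < M%:R :> R by rewrite ltr0n.
have Mb : 6 / M%:R <= b.
  rewrite ler_pdivrMr// mulrC -ler_pdivrMr// ltW//.
  by have /andP[] := truncn_itv (ltW (divr_gt0 (ltr0Sn R 5) b0)).
have M60 : 0 <= 6 / M%:R :> R by rewrite divr_ge0.
apply: (@le_trans _ _ (\sum_(0 <= k <oo) diam_pow (2 + e) (grid_cell M k))%E).
  apply: ereal_inf_lbound; exists (grid_cell M) => //; split.
    exact: subset_trans (grid_cell_cover _).
  move=> k; apply: (le_trans (diam_grid_cell _ _)).
  by rewrite lee_fin (le_trans Mb)// ge_min lexx.
rewrite (nneseries_split _ (M * M)); last by move=> k _; exact: diam_pow_ge0.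
rewrite add0n eseries0 ?adde0; last first.
  by move=> k kM _; rewrite /grid_cell ltnNge kM /= /diam_pow eqxx.
apply: (@le_trans _ _ (\sum_(0 <= k < M * M) ((6 / M%:R) `^ (2 + e))%:E)%E).
  apply: lee_sum => k _; rewrite /diam_pow; case: ifP => [_|_].
    by rewrite lee_fin powR_ge0.
  have dfin : diam (grid_cell M k) \is a fin_num.
    by rewrite ge0_fin_numE ?diam_ge0// (le_lt_trans (diam_grid_cell _ _)) ?ltry.
  rewrite -(fineK dfin) poweR_EFin lee_fin ge0_ler_powR//.
  - by rewrite addr_ge0// ltW.
  - by rewrite nnegrE fine_ge0 ?diam_ge0.
  - by rewrite -lee_fin fineK// diam_grid_cell.
rewrite sumEFin lee_fin sumr_const_nat subn0 -[leLHS]mulr_natl natrM.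
rewrite powRD; last by apply/implyP => _; rewrite gt_eqF// divr_gt0.
rewrite powR_mulrn//.
have -> : M%:R * M%:R * ((6 / M%:R) ^+ 2 * (6 / M%:R) `^ e) =
    36 * (6 / M%:R) `^ e :> R.
  by field; rewrite gt_eqF.
rewrite mulrC -ler_pdivlMr//.
have -> : eps / 36 = ((eps / 36) `^ e^-1) `^ e.
  by rewrite -powRrM mulVf ?gt_eqF// powRr1// divr_ge0// ltW.
apply: ge0_ler_powR; rewrite ?nnegrE ?powR_ge0//; first exact: ltW.
by rewrite (le_trans Mb)// ge_min lexx orbT.
Qed.

End dimension.

(** * Existence and localization of attractors *)

Section attractors.
Context {R : realType}.
Local Notation C := (R[i]^o).

Lemma normc_continuous : continuous (@normc R : C -> R).
Proof.
move=> z; apply/(@cvgrPdist_lt _ _ _ (nbhs (z : C)) (nbhs_filter (z : C))) => e e0.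
have e0' : 0 < e%:C by rewrite ltcR.
apply: (@filterS _ _ (nbhs_filter (z : C)) _ _ _ (nbhsx_ballx (z : C) _ e0')).
move=> w zw /=; have {}zw : normc (z - w) < e by rewrite -ltcR.
apply: le_lt_trans zw.
by rewrite ler_norml normcB_ge andbT lerNl opprB normcB_sym normcB_ge.
Qed.

Lemma Complex_continuous : continuous (fun p : R * R => (p.1 +i* p.2 : C)).
Proof.
(* The radius [e] is complex; its positivity forces a zero imaginary part, so it is a real
   number. *)
move=> p; apply/cvgrPdist_lt => e; rewrite ltcE /= => /andP[/eqP Ime e0].
have -> : e = (complex.Re e)%:C by case: e Ime {e0} => a b /= ->.
have e2 : 0 < complex.Re e / 2 by rewrite divr_gt0.
have h1 : \forall q \near p, `|p.1 - q.1| < complex.Re e / 2.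
  exact: (@cvgr_dist_lt _ _ _ (nbhs p) _ fst p.1 (@cvg_fst _ _ (nbhs p.1) (nbhs p.2) _) _ e2).
have h2 : \forall q \near p, `|p.2 - q.2| < complex.Re e / 2.
  exact: (@cvgr_dist_lt _ _ _ (nbhs p) _ snd p.2 (@cvg_snd _ _ (nbhs p.1) (nbhs p.2) _) _ e2).
apply: filterS2 h1 h2 => q q1 q2; rewrite normcE_C ltcR.
apply: (le_lt_trans (normc_leDReIm _)) => /=.
by rewrite [ltRHS]splitr ltrD.
Qed.

(** The disk is a closed subset of the continuous image of the real square [[-1, 1]^2]. *)
Lemma compact_disk : compact ([set z | normc z <= 1] : set C).
Proof.
have sq : compact ((`[-1, 1] : set R) `*` (`[-1, 1] : set R)).
  by apply: compact_setX; exact: segment_compact.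
apply: (subclosed_compact _ (continuous_compact _ sq)).
- apply: (@closed_comp _ _ (@normc R : C -> R) [set x | x <= 1]).
    by move=> z _; exact: normc_continuous.
  exact: closed_le.
- by apply: continuous_subspaceT; exact: Complex_continuous.
- move=> z /= z1; exists (complex.Re z, complex.Im z); last by case: z {z1}.
  split => /=; rewrite in_itv /= -ler_norml.
    exact: le_trans (normc_geRe _) z1.
  exact: le_trans (normc_geIm _) z1.
Qed.

Variable I : set (R[i] -> R[i]).

(* The attractor is the union of all subsets of the disk contained in their own
   image under the Hutchinson operator. *)
Lemma attractorP : finite_set I ->
  (forall f, I f -> continuous (f : C -> C)) ->
  (forall f z, I f -> normc z <= 1 -> normc (f z) <= 1) ->
  (exists f z, [/\ I f, normc z <= 1 & f z = z]) ->
  is_attractor I (attractor I).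
Proof.
move=> fin_I cont_I disk_I [g [p [Ig p1 gp]]].
pose D := [set z : R[i] | normc z <= 1].
pose Phi A := \bigcup_(f in I) (f @` A).
pose F := \bigcup_(A in [set A | A `<=` D /\ A `<=` Phi A]) A.
have FD : F `<=` D by move=> z [A [AD _] Az]; exact: AD.
have PhiS A B : A `<=` B -> Phi A `<=` Phi B.
  by move=> AB z [f If [x Ax <-]]; exists f => //; exists x => //; exact: AB.
have F_Phi : F `<=` Phi F.
  move=> z [A [AD AA] Az]; apply: (PhiS A); last exact: AA.
  by move=> x Ax; exists A.
have Phi_F : Phi F `<=` F.
  move=> z Fz; exists (Phi F) => //; split; last exact: PhiS.
  by move=> _ [f If [x Fx <-]]; apply: disk_I => //; exact: FD.
have Dclosed : closed (D : set C).
  exact: compact_closed (@norm_hausdorff _ _) compact_disk.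
have clD : closure (F : set C) `<=` D.
  by rewrite (closure_id (D : set C)).1//; exact: closureS.
have clcompact : compact (closure (F : set C)).
  exact: subclosed_compact (@closed_closure _ _) compact_disk clD.
have Phicl : closed (Phi (closure (F : set C)) : set C).
  apply: closed_bigcup => // f If; apply: compact_closed (@norm_hausdorff _ _) _.
  apply: (@continuous_compact C C f _ _ clcompact).
  exact: continuous_subspaceT (cont_I _ If).
(* The closure of [F] is itself one of the sets in the union: [Phi] of it is closed and contains
   [F], hence contains the closure. *)
have clF : closure (F : set C) `<=` F.
  move=> z clz; exists (closure (F : set C)) => //; split => //.
  rewrite [X in _ `<=` X]((closure_id _).1 Phicl).
  apply: (@closureS C F); apply: (subset_trans F_Phi); apply: PhiS.
  exact: (@subset_closure C).
have F_attr : is_attractor I F.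
  split.
  (* The singleton of a fixed point is contained in its own image, which makes the union
     nonempty. *)
  - exists p; exists [set p] => //; split; first by move=> _ ->.
    by move=> _ ->; exists g => //; exists p.
  - by have <- : closure (F : set C) = F
      by apply/seteqP; split => //; exact: subset_closure.
  - by apply/seteqP.
exact: (@xgetPex _ set0 [set F | is_attractor I F]) (ex_intro _ F F_attr).
Qed.

(** A point of maximal modulus is the image of another point of [F], so the maximum [M] satisfies
    [M <= q * M + (1 - q)], that is [M <= 1]. *)
Lemma attractor_sub_disk F :
  (forall f, I f -> exists2 q, 0 <= q < 1 &
    forall z, normc (f z) <= q * normc z + (1 - q)) ->
  is_attractor I F -> F `<=` [set z | normc z <= 1].
Proof.
move=> contr [F0 Fcpt FE].
have [z0 /set_mem Fz0 z0max] := @compact_EVT_max C R _ F F0 Fcpt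
  (continuous_subspaceT normc_continuous).
have := Fz0; rewrite {1}FE => -[f If [w Fw fw]].
have [q /andP[q0 q1] fq] := contr f If.
have := z0max w (mem_set Fw); have := fq w; rewrite fw => h1 h2.
move=> z /mem_set/z0max /= h; apply: (le_trans h).
rewrite -(ler_pM2l (_ : 0 < 1 - q)) ?subr_gt0// mulr1.
have := ler_wpM2l q0 h2; lra.
Qed.

End attractors.

(** * Estimates for the contraction ratios and the distances between vertices *)

Section ratio_estimates.
Context {R : realType}.
Implicit Types x : R.

Lemma sinMVT x : 0 <= x -> exists2 c, 0 <= c <= x & sin x = cos c * x.
Proof.
move=> x0; have sin_cont : {within `[0, x], continuous (@sin R)}.
  by apply: continuous_subspaceT; exact: continuous_sin.
have [c] := MVT_segment x0 (fun y _ => is_derive_sin y) sin_cont.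
by rewrite in_itv/= sin0 !subr0 => cx ->; exists c.
Qed.

Lemma normr_sin_le x : `|sin x| <= `|x|.
Proof.
wlog x0 : x / 0 <= x => [h|].
  have [/h//|x0] := leP 0 x.
  by rewrite -normrN -sinN -[leRHS]normrN; apply: h; rewrite oppr_ge0 ltW.
have [c _ ->] := sinMVT x0.
by rewrite normrM ler_piMl// ler_norml cos_geN1 cos_le1.
Qed.

Lemma cos_half x : cos x = 1 - 2 * sin (x / 2) ^+ 2.
Proof.
have := cosD (x / 2) (x / 2); rewrite -splitr -!expr2 cos2sin2 => ->.
by ring.
Qed.

Lemma cos_ge x : 1 - x ^+ 2 / 2 <= cos x.
Proof.
rewrite cos_half.
have : sin (x / 2) ^+ 2 <= (x / 2) ^+ 2.
  rewrite -real_normK ?num_real// -(real_normK (num_real (x / 2))).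
  by rewrite lerXn2r ?nnegrE// normr_sin_le.
by rewrite expr_div_n; lra.
Qed.

Lemma sin_ge x : 0 <= x -> x <= 1 -> x / 2 <= sin x.
Proof.
move=> x0 x1; have [c /andP[c0 cx] ->] := sinMVT x0.
rewrite mulrC ler_wpM2r//; have := cos_ge c.
have : c ^+ 2 <= 1 by rewrite expr_le1// (le_trans cx).
lra.
Qed.

(** The product-to-sum formula isolates the angle [(2m - 1) pi / n], which is close to [pi / 2] when
    [m] is close to [n / 4]. *)
Lemma vertex_ratioE n m : let x : R := pi / n%:R in
  vertex_ratio n m = sin x / (sin ((2 * m%:R - 1) * x) + sin x).
Proof.
move=> x; rewrite /vertex_ratio -/x -!mulrA -/x; congr (_ / _).
have -> : (2 * m%:R - 1) * x = m%:R * x + (m%:R - 1) * x by ring.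
have -> : sin x = sin (m%:R * x - (m%:R - 1) * x) by congr sin; ring.
by rewrite sinD sinB; ring.
Qed.

Section large_n.
Variables (n m : nat).
Hypothesis n_large : (128 <= n)%N.
Hypothesis m_lb : n%:R / 4 <= m%:R :> R.
Hypothesis m_ub : m%:R <= n%:R / 4 + 1 :> R.

Local Notation x := (pi / n%:R : R).
Local Notation P := (vertex_ratio n m : R).

Let n_ge : 128 <= n%:R :> R. Proof. by rewrite ler_nat. Qed.
Let n_gt0 : 0 < n%:R :> R. Proof. by rewrite ltr0n (leq_trans _ n_large). Qed.

Let x_lb : 2 / n%:R <= x. Proof. by rewrite ler_pM2r ?invr_gt0// pi_ge2. Qed.
Let x_ub : x <= 4 / n%:R.
Proof. by rewrite ler_pM2r ?invr_gt0//; have := @pihalf_lt2 R; lra. Qed.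
Let x_gt0 : 0 < x. Proof. by rewrite divr_gt0// pi_gt0. Qed.
Let x_small : x <= 1 / 32.
Proof. by apply: (le_trans x_ub); rewrite ler_pdivrMr//; have := n_ge; lra. Qed.

Let s_lb : x / 2 <= sin x.
Proof. by rewrite sin_ge// ?(ltW x_gt0)// (le_trans x_small)//; lra. Qed.
Let s_ub : sin x <= x.
Proof.
by have := normr_sin_le x; rewrite (gtr0_norm x_gt0); apply: le_trans; rewrite ler_norm.
Qed.
Let c_lb (y : R) : `|y| <= x -> 9 / 10 <= cos y.
Proof.
move=> yx; have := cos_ge y.
have : y ^+ 2 <= 1 / 10.
  rewrite -real_normK ?num_real//.
  have : `|y| <= 1 / 10 by have := x_small; lra.
  by have := normr_ge0 y; nra.
lra.
Qed.

(** The range [[n/4, n/4 + 1]] of [m] says exactly that [(2m - 1) x] is within [x] of [pi / 2]. *)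
Let sigma_lb : 9 / 10 <= sin ((2 * m%:R - 1) * x).
Proof.
rewrite -cosBpihalf; apply: c_lb.
have -> : (2 * m%:R - 1) * x - pi / 2 = (2 * m%:R - 1 - n%:R / 2) * x.
  by field; rewrite gt_eqF.
rewrite normrM (gtr0_norm x_gt0) ler_piMl// ?(ltW x_gt0)//.
rewrite ler_norml; move: m_lb m_ub => ? ?; apply/andP; split; lra.
Qed.

Let sum_lb : 9 / 10 <= sin ((2 * m%:R - 1) * x) + sin x.
Proof. by move: sigma_lb s_lb x_gt0; lra. Qed.

Let sum_ub : sin ((2 * m%:R - 1) * x) + sin x <= 2.
Proof. by rewrite -[leRHS]/(1 + 1) lerD ?sin_le1. Qed.

Let sum_gt0 : 0 < sin ((2 * m%:R - 1) * x) + sin x.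
Proof. by move: sum_lb; lra. Qed.

Let s_gt0 : 0 < sin x.
Proof. by move: s_lb x_gt0; lra. Qed.

Lemma vertex_ratio_gt0 : 0 < P.
Proof. by rewrite vertex_ratioE divr_gt0. Qed.

Lemma vertex_ratio_lb : 1 / (2 * n%:R) <= P.
Proof.
rewrite vertex_ratioE ler_pdivlMr//.
have x4 : 1 / (2 * n%:R) <= x / 4.
  apply: le_trans (_ : (2 / n%:R) / 4 <= _); last by move: x_lb; lra.
  by rewrite le_eqVlt; apply/orP; left; apply/eqP; field; rewrite gt_eqF.
apply: (@le_trans _ _ (x / 4 * 2)); last by move: s_lb; lra.
by apply: (ler_pM _ (ltW sum_gt0) x4 sum_ub); rewrite divr_ge0.
Qed.

Lemma vertex_ratio_ub : P <= 5 / n%:R.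
Proof.
rewrite vertex_ratioE ler_pdivrMr//.
apply: (@le_trans _ _ (5 / n%:R * (9 / 10))).
  have : 0 < n%:R^-1 :> R by rewrite invr_gt0.
  by move: s_ub x_ub; lra.
by rewrite ler_pM2l ?divr_gt0.
Qed.

Lemma vertex_ratio_small : P <= 1 / 20.
Proof. by apply: (le_trans vertex_ratio_ub); rewrite ler_pdivrMr//; have := n_ge; lra. Qed.

(* Separates every second disk of a ring; neighbouring ones may overlap. *)
Lemma vertex_gap : P < (1 - P) * sin (2 * x).
Proof.
(* Over the common denominator the claim becomes [1 < 2 * sin ((2m - 1) x) * cos x], and both
   factors are at least 9/10. *)
have -> : 1 - P = sin ((2 * m%:R - 1) * x) / (sin ((2 * m%:R - 1) * x) + sin x).
  by rewrite vertex_ratioE; field; rewrite gt_eqF.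
rewrite vertex_ratioE mulrAC ltr_pM2r ?invr_gt0//.
have -> : sin (2 * x) = 2 * (cos x * sin x).
  by rewrite (_ : 2 * x = x + x) ?sinD; ring.
have c1 : 9 / 10 <= cos x by apply: c_lb; rewrite gtr0_norm.
have : 81 / 100 <= sin ((2 * m%:R - 1) * x) * cos x.
  by move: sigma_lb c1; nra.
move: s_gt0; move: (sin x) (sin _) (cos x) => S Sg c; nra.
Qed.

Variable l : nat.
Hypothesis l_le1 : (l <= 1)%N.

Let cl_lb : 9 / 10 <= cos (l%:R * pi / n%:R : R).
Proof.
rewrite -mulrA; apply: c_lb; rewrite normrM (gtr0_norm x_gt0).
by rewrite ler_piMl ?(ltW x_gt0)// normr_nat -[leRHS]/(1%:R) ler_nat.
Qed.

Let factor_bounds : 1 < (1 - P) * (1 + cos (l%:R * pi / n%:R)) <= 2.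
Proof.
have := cos_le1 (l%:R * pi / n%:R : R); have := vertex_ratio_gt0.
move: cl_lb vertex_ratio_small; move: P (cos _) => p c ? ? ? ?.
by apply/andP; split; nra.
Qed.

Let c2E : central_ratio n m l ^+ 2 =
  1 - 2 * P * ((1 - P) * (1 + cos (l%:R * pi / n%:R))) :> R.
Proof.
(* The remaining goal is that the radicand is nonnegative; it follows from [P <= 1/20] and the
   factor being at most 2. *)
rewrite sqr_sqrtr; first by ring.
rewrite -[leRHS]/(_ + _) (_ : _ + 1 =
  1 - 2 * P * ((1 - P) * (1 + cos (l%:R * pi / n%:R)))); last by ring.
have := vertex_ratio_gt0; move: vertex_ratio_small factor_bounds => + /andP[].
by move: (_ * (1 + _)) => e; move: P => p; nra.
Qed.

(** Controls how fast the rings shrink: about [1 / P] of them keep a radius bounded below. *)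
Lemma central_ratio_lb : 1 - 4 * P <= central_ratio n m l ^+ 2 :> R.
Proof.
rewrite c2E; have := vertex_ratio_gt0; move: factor_bounds => /andP[].
by move: (_ * (1 + _)) => e; move: P => p; nra.
Qed.

(** Separates every second ring: the disks [S_k] of the unit disk have modulus at least [1 - 2P],
    while their images under [S_c^2] have modulus at most [c ^ 2]. *)
Lemma central_ratio_ub : central_ratio n m l ^+ 2 < 1 - 2 * P :> R.
Proof.
rewrite c2E; have := vertex_ratio_gt0; move: factor_bounds => /andP[].
by move: (_ * (1 + _)) => e; move: P => p; nra.
Qed.

End large_n.

Lemma normc_cisB (a b : R) : normc (cis a - cis b) = 2 * `|sin ((a - b) / 2)|.
Proof.
have -> : 2 * `|sin ((a - b) / 2)| = Num.sqrt ((2 * sin ((a - b) / 2)) ^+ 2).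
  by rewrite sqrtr_sqr normrM gtr0_norm.
rewrite /normc /cis /=; congr Num.sqrt.
have -> : (2 * sin ((a - b) / 2)) ^+ 2 = 2 - 2 * cos (a - b).
  by rewrite [cos _]cos_half; ring.
rewrite cosB.
have := cos2Dsin2 a; have := cos2Dsin2 b.
move: (cos a) (cos b) (sin a) (sin b) => ca cb sa sb h2 h1.
transitivity ((ca ^+ 2 + sa ^+ 2) + (cb ^+ 2 + sb ^+ 2) - 2 * (ca * cb + sa * sb)).
  by ring.
by rewrite h1 h2; ring.
Qed.

(** The bound [(j - i) * 4 <= n] keeps half the angle between the vertices within [[0, pi / 2]],
    where sine increases, so the shortest chord occurs at [j - i = 1]. *)
Lemma vertex_dist n i j : (4 <= n)%N -> (i < j)%N -> ((j - i) * 4 <= n)%N ->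
  2 * sin (2 * (pi / n%:R)) <= normc (vertex n (2 * j) - vertex n (2 * i) : R[i]).
Proof.
move=> n4 ij jn.
have n0 : 0 < n%:R :> R by rewrite ltr0n (leq_trans _ n4).
rewrite normc_cisB ler_pM2l//.
have -> : (2 * pi * (2 * j)%:R / n%:R - 2 * pi * (2 * i)%:R / n%:R) / 2 =
    (j - i)%:R * (2 * (pi / n%:R)) :> R.
  by rewrite !natrM natrB ?(ltnW ij)//; field; rewrite gt_eqF.
have x0 : 0 < pi / n%:R :> R by rewrite divr_gt0// pi_gt0.
have d1 : 1 <= (j - i)%:R :> R by rewrite -[leLHS]/(1%:R) ler_nat subn_gt0.
have d2 : (j - i)%:R * (2 * (pi / n%:R)) <= pi / 2 :> R.
  have : ((j - i) * 4)%:R <= n%:R :> R by rewrite ler_nat.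
  rewrite natrM => h; rewrite !mulrA ler_pdivrMr//.
  by have := @pi_gt0 R; nra.
apply: le_trans (ler_norm _).
have d3 : 2 * (pi / n%:R) <= (j - i)%:R * (2 * (pi / n%:R)) :> R by nra.
by rewrite leNgt ltr_sin -?leNgt// in_itv/=; apply/andP; split; have := @pi_gt0 R; lra.
Qed.

End ratio_estimates.

(** * Dimension bounds for a single fractal with large [n] *)

Section polygonal_fractal_dimension.
Context {R : realType}.
Variables (n m l : nat) (theta : R).
Hypothesis n_large : (128 <= n)%N.
Hypothesis m_lb : n%:R / 4 <= m%:R :> R.
Hypothesis m_ub : m%:R <= n%:R / 4 + 1 :> R.
Hypothesis l_le1 : (l <= 1)%N.

Local Notation C := (R[i]^o).
Local Notation P := (vertex_ratio n m : R).
Local Notation c := (central_ratio n m l : R).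
Local Notation F := (polygonal_fractal n m l theta).
Local Notation disk := [set z : R[i] | normc z <= 1].

Let P_gt0 : 0 < P. Proof. exact: vertex_ratio_gt0. Qed.
Let P_small : P <= 1 / 20. Proof. exact: vertex_ratio_small. Qed.
Let c2_lb : 1 - 4 * P <= c ^+ 2. Proof. exact: central_ratio_lb. Qed.
Let c2_ub : c ^+ 2 < 1 - 2 * P. Proof. exact: central_ratio_ub. Qed.
Let c_ge0 : 0 <= c. Proof. exact: sqrtr_ge0. Qed.
Let c_lt1 : c < 1.
Proof. by rewrite -(@expr_lt1 _ 2)//; move: c2_ub P_gt0; lra. Qed.

Let normc_vertex_scaled (k : nat) : normc ((1 - P)%:C * vertex n k) = 1 - P.
Proof. by rewrite normcM normcR normc_cis mulr1 ger0_norm//; move: P_small; lra. Qed.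

Lemma vertex_mapB k (z w : R[i]) :
  normc (vertex_map n m k z - vertex_map n m k w) = P * normc (z - w).
Proof.
rewrite /vertex_map opprD addrACA subrr addr0 -mulrBr normcM normcR.
by rewrite gtr0_norm.
Qed.

Lemma vertex_map_le k (z : R[i]) : normc (vertex_map n m k z) <= P * normc z + (1 - P).
Proof.
by rewrite (le_trans (normcD_le _ _))// normc_vertex_scaled normcM normcR gtr0_norm.
Qed.

Lemma vertex_map_ge k (z : R[i]) : normc z <= 1 -> 1 - 2 * P <= normc (vertex_map n m k z).
Proof.
move=> z1; have := normcB_ge ((1 - P)%:C * vertex n k) (- (P%:C * z)).
rewrite opprK [_ + P%:C * z]addrC normc_opp normc_vertex_scaled => h.
apply: le_trans h; rewrite normcM normcR gtr0_norm//.
have : P * normc z <= P by rewrite ler_piMr// ltW.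
lra.
Qed.

Lemma normc_central_map (z : R[i]) : normc (central_map n m l theta z) = c * normc z.
Proof. by rewrite /central_map !normcM normcR normc_cis mulr1 ger0_norm. Qed.

Lemma iter_central_map k (z : R[i]) :
  iter k (central_map n m l theta) z = (c%:C * cis theta) ^+ k * z.
Proof.
by elim: k => [|k IH]; rewrite ?expr0 ?mul1r//= IH /central_map exprS mulrA.
Qed.

Lemma polygonal_fractalP :
  is_attractor ([set vertex_map n m k | k in [set k | (1 <= k <= n)%N]]
             `|` [set central_map n m l theta]) F.
Proof.
apply: attractorP.
- rewrite finite_setU; split; last exact: finite_set1.
  apply: finite_image; apply: (sub_finite_set _ (finite_II n.+1)) => k /=.
  by case/andP.
- have affine (a b : R[i]) : continuous ((fun z => a * z + b) : C -> C).
    move=> z; exact: (@cvgD R[i] C _ (nbhs (z : C)) _ _ _ _ _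
      (@cvgM R[i] _ (nbhs (z : C)) _ _ _ _ _ (cvg_cst _) cvg_id) (cvg_cst _)).
  move=> f [[k _ <-]|->]; first exact: affine.
  have -> : central_map n m l theta = fun z => (c%:C * cis theta) * z + 0.
    by apply/funext => z; rewrite addr0.
  exact: affine.
- move=> f z [[k _ <-]|->] z1.
    rewrite (le_trans (vertex_map_le _ _))//.
    have : P * normc z <= P by rewrite ler_piMr// ltW.
    lra.
  by rewrite normc_central_map mulr_ile1// ?normc_ge0// ltW.
- exists (central_map n m l theta), 0; split; first by right.
    by rewrite normc0.
  by rewrite /central_map mulr0.
Qed.

Lemma polygonal_fractal_sub_disk : F `<=` disk.
Proof.
apply: attractor_sub_disk polygonal_fractalP => f [[k _ <-]|->].
  exists P; first by rewrite (ltW P_gt0)/=; move: P_small; lra.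
  exact: vertex_map_le.
exists c; first by rewrite c_ge0.
by move=> z; rewrite normc_central_map lerDl subr_ge0 ltW.
Qed.

Lemma vertex_map_fractal k (z : R[i]) : (1 <= k <= n)%N -> F z -> F (vertex_map n m k z).
Proof.
move=> kn Fz; have [_ _ FE] := polygonal_fractalP.
rewrite FE; exists (vertex_map n m k); first by left; exists k.
by exists z.
Qed.

Lemma central_map_fractal (z : R[i]) : F z -> F (central_map n m l theta z).
Proof.
move=> Fz; have [_ _ FE] := polygonal_fractalP.
by rewrite FE; exists (central_map n m l theta); [right|exists z].
Qed.

(** Since [P <= 5 / n], one has [4 * q * P <= 20 / 64 < 1 / 2], so the rings used keep radius at
    least 1/2. Also [2 * q <= n] keeps vertex indices in range, and [4 * q <= n] serves
    [vertex_dist]. *)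
Let q := (n %/ 64)%N.

(* The sub-system S_c^(2j) o S_(2(k+1)), for j, k < q: every second disk in
   every second one of the first 2q rings. *)
Let sub_map (i : 'I_q * 'I_q) (z : R[i]) : R[i] :=
  iter (2 * i.1) (central_map n m l theta) (vertex_map n m (2 * i.2.+1) z).

Let n_gt0 : 0 < n%:R :> R. Proof. by rewrite ltr0n (leq_trans _ n_large). Qed.

Let cpow_lb (j : 'I_q) : 1 / 2 <= c ^+ (2 * j).
Proof.
(* Bernoulli's inequality for [(1 - 4P) ^ k], carried out directly on the powers of [c ^ 2]. *)
have bernoulli (k : nat) : 1 - k%:R * (4 * P) <= (c ^+ 2) ^+ k.
  elim: k => [|k IH]; first by rewrite expr0 mul0r subr0.
  have k0 : 0 <= k%:R :> R by [].
  rewrite exprS -natr1.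
  have c2_0 : 0 <= c ^+ 2 by rewrite exprn_ge0.
  move: IH c2_lb c2_ub P_gt0 P_small; move: (c ^+ 2) c2_0 => d d0.
  move: (d ^+ k) => dk IH h1 h2 h3 h4.
  move: P IH h1 h2 h3 h4 => p IH h1 h2 h3 h4.
  have : d * (1 - k%:R * (4 * p)) <= d * dk by rewrite ler_wpM2l.
  have : 0 <= k%:R * p * (1 - d).
    by apply: mulr_ge0; [apply: mulr_ge0 => //; exact: ltW|lra].
  lra.
rewrite exprM; apply: le_trans (bernoulli j).
have jn : j%:R * 64 <= n%:R :> R.
  rewrite -natrM ler_nat (leq_trans _ (leq_trunc_div n 64))// leq_mul2r.
  exact: ltnW.
have : n%:R * P <= 5.
  by rewrite mulrC -ler_pdivlMr//; exact: vertex_ratio_ub.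
have : 0 <= j%:R :> R by [].
by move: P_gt0; nra.
Qed.

Let sub_map_sim i (z w : R[i]) :
  normc (sub_map i z - sub_map i w) = c ^+ (2 * i.1) * P * normc (z - w).
Proof.
rewrite /sub_map !iter_central_map -mulrBr normcM vertex_mapB normcX normcM.
by rewrite normcR normc_cis mulr1 ger0_norm// mulrA.
Qed.

Let sub_map_fractal i : sub_map i @` F `<=` F.
Proof.
move=> _ [z Fz <-]; rewrite /sub_map.
have : F (vertex_map n m (2 * i.2.+1) z).
  (* The successor in [2 * i.2.+1] avoids the index 0: the vertices run over 2, 4, ..., 2q, all
     between 1 and [n]. *)
  apply: vertex_map_fractal => //=.
  rewrite (leq_trans _ (leq_trunc_div n 64))//.
  by rewrite (leq_trans (leq_mul (leqnn 2) (ltn_ord i.2)))// mulnC leq_mul2l orbT.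
by elim: (2 * i.1)%N => //= k IH /IH; exact: central_map_fractal.
Qed.

(** The first entry is half the gap between neighbouring selected disks of the outermost ring, the
    second is half the radial gap between the first two selected rings. The factor 1/2 accounts for
    the shrinking by [c ^ (2 * j) >= 1 / 2]. *)
Let delta := Num.min ((1 - P) * sin (2 * (pi / n%:R)) - P) ((1 - 2 * P - c ^+ 2) / 2).

Let delta_gt0 : 0 < delta.
Proof.
rewrite lt_min subr_gt0 vertex_gap//= divr_gt0// subr_gt0; exact: c2_ub.
Qed.

Let sub_map_sep i j : i != j ->
  forall z w, F z -> F w -> delta <= normc (sub_map i z - sub_map j w).
Proof.
have ring_sep (i1 j1 i2 j2 : 'I_q) z w : (i1 < j1)%N -> F z -> F w ->
    delta <= normc (sub_map (i1, i2) z - sub_map (j1, j2) w).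
  move=> ij /polygonal_fractal_sub_disk /= z1 /polygonal_fractal_sub_disk /= w1.
  apply: le_trans (normcB_ge _ _).
  rewrite /sub_map !iter_central_map/= !normcM !normcX !normcM normcR normc_cis.
  rewrite mulr1 ger0_norm//.
  have := vertex_map_ge (2 * i2.+1) z1; have := vertex_map_le (2 * j2.+1) w.
  have : P * normc w <= P by rewrite ler_piMr// ltW.
  (* The inner ring carries at least one more factor [c ^ 2], so the radial gap is at least
     [c ^ (2 * i1) * (1 - 2P - c ^ 2)]. *)
  have := P_small; have := P_gt0; have : c ^+ (2 * j1) <= c ^+ (2 * i1) * c ^+ 2.
    by rewrite -exprD ler_wiXn2l ?c_ge0 ?(ltW c_lt1)// -mulnSr leq_mul2l.
  have : delta <= (1 - 2 * P - c ^+ 2) / 2 by rewrite ge_min lexx orbT.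
  have := cpow_lb i1; have := c2_ub; have : 0 <= c ^+ (2 * j1) by rewrite exprn_ge0.
  move: (normc (vertex_map _ _ _ z)) (normc (vertex_map _ _ _ w)) => vz vw.
  move: (c ^+ (2 * j1)) (c ^+ (2 * i1)) (c ^+ 2) => cj ci c2 *.
  have : cj * vw <= cj * 1 by rewrite ler_wpM2l//; lra.
  have : ci * (1 - 2 * P) <= ci * vz by rewrite ler_wpM2l//; lra.
  nra.
have angle_sep (i1 i2 j2 : 'I_q) z w : (i2 < j2)%N -> F z -> F w ->
    delta <= normc (sub_map (i1, i2) z - sub_map (i1, j2) w).
  move=> ij /polygonal_fractal_sub_disk /= z1 /polygonal_fractal_sub_disk /= w1.
  rewrite /sub_map !iter_central_map/= -mulrBr normcM normcX normcM normcR normc_cis.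
  rewrite mulr1 ger0_norm//.
  have delta_le : delta <= (1 - P) * sin (2 * (pi / n%:R)) - P.
    by rewrite ge_min lexx.
  have vdist : 2 * sin (2 * (pi / n%:R)) <=
      normc (vertex n (2 * j2.+1) - vertex n (2 * i2.+1) : R[i]).
    apply: vertex_dist => //; first exact: leq_trans n_large.
    rewrite subSS (leq_trans _ (leq_trunc_div n 64))//.
    rewrite (leq_trans (leq_mul (leq_trans (leq_subr _ _) (ltnW (ltn_ord j2))) (leqnn 4)))//.
    by rewrite leq_mul2l orbT.
  (* Distance between the two centres minus the two radii [P]. *)
  have vsep : (1 - P) * (2 * sin (2 * (pi / n%:R))) - 2 * P <=
      normc (vertex_map n m (2 * i2.+1) z - vertex_map n m (2 * j2.+1) w).
    have -> : vertex_map n m (2 * i2.+1) z - vertex_map n m (2 * j2.+1) w =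
        P%:C * (z - w) -
        (1 - P)%:C * (vertex n (2 * j2.+1) - vertex n (2 * i2.+1)).
      by rewrite /vertex_map; ring.
    rewrite normcB_sym; apply: le_trans (normcB_ge _ _).
    rewrite !normcM !normcR (gtr0_norm P_gt0) ger0_norm; last by move: P_small; lra.
    have := normc_tri z 0 w; rewrite subr0 (normcB_sym 0) subr0 => zw.
    have : P * normc (z - w) <= P * 2 by rewrite ler_pM2l//; lra.
    have : (1 - P) * (2 * sin (2 * (pi / n%:R))) <=
      (1 - P) * normc (vertex n (2 * j2.+1) - vertex n (2 * i2.+1) : R[i]).
      by rewrite ler_wpM2l//; move: P_small; lra.
    lra.
  have := cpow_lb i1; have := delta_gt0.
  move: vsep delta_le; move: (normc _) (sin _) (c ^+ _) delta => v s ci d *.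
  have : 1 / 2 * v <= ci * v by rewrite ler_wpM2r//; lra.
  lra.
case: i j => [i1 i2] [j1 j2] ij z w Fz Fw.
have [lt1|gt1|eq1] := ltngtP i1 j1.
- exact: ring_sep.
- by rewrite normcB_sym; exact: ring_sep.
have {}eq1 : i1 = j1 by exact: val_inj.
subst j1; have [lt2|gt2|eq2] := ltngtP i2 j2.
- exact: angle_sep.
- by rewrite normcB_sym; exact: angle_sep.
by move: ij; rewrite (val_inj eq2) eqxx.
Qed.

(** The inequality on [n] is the Moran condition [N * r ^ s >= 1] for [N >= (n / 128) ^ 2] maps of
    ratio at least [r = 1 / (4n)]. *)
Lemma polygonal_fractal_dim_ge (s : R) :
  0 <= s -> (4 * n%:R) `^ s <= (n%:R / 128) ^+ 2 -> (s%:E <= hausdorff_dim F)%E.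
Proof.
move=> s0 n_s; apply: hausdorff_dim_ge => t t0 ts.
exists (delta `^ t); first exact: powR_gt0.
have [F0 Fcpt _] := polygonal_fractalP.
apply: hausdorff_premeasure_ge => // D U d d0 dU DF.
have r0 : 0 < (4 * n%:R)^-1 :> R by rewrite invr_gt0 mulr_gt0.
have q_gt1 : (1 < q)%N by rewrite (@leq_div2r 64 128).
apply: (finite_cover_sum sub_map_sim r0 _ _ F0 sub_map_fractal delta_gt0
  sub_map_sep t0 _ d0 dU DF) => //.
- move=> i; have := cpow_lb i.1; have := vertex_ratio_lb n_large m_lb m_ub.
  have -> : (4 * n%:R)^-1 = 1 / 2 * (1 / (2 * n%:R)) :> R.
    by field; rewrite gt_eqF.
  by move=> h1 h2; apply: ler_pM => //; rewrite divr_ge0// mulr_ge0// ltW.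
- by rewrite card_prod !card_ord (leq_trans q_gt1)// leq_pmulr// ltnW.
have n1 : 1 <= 4 * n%:R :> R.
  by have : 128%:R <= n%:R :> R by [rewrite ler_nat]; lra.
(* Rounding down costs at most one: [q > n / 64 - 1], and [n / 128 >= 1]. *)
have q_lb : n%:R / 128 <= q%:R :> R.
  have : (n < (q.+1) * 64)%N by rewrite ltn_ceil.
  rewrite -(ltr_nat R) natrM -natr1 => h.
  have : (128 : R) <= n%:R by rewrite ler_nat.
  rewrite ler_pdivrMr//; lra.
rewrite card_prod !card_ord natrM -expr2.
have -> : (4 * n%:R)^-1 `^ t = ((4 * n%:R) `^ t)^-1.
  by rewrite -powR_inv1 ?mulr_ge0// -powRrM mulN1r powRN.
rewrite ler_pdivlMr ?powR_gt0 ?mulr_gt0// mul1r.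
apply: (@le_trans _ _ ((4 * n%:R) `^ s)); first by rewrite ler_powR// ltW.
by apply: (le_trans n_s); rewrite lerXn2r ?nnegrE ?divr_ge0.
Qed.

Lemma polygonal_fractal_dim_le2 : (hausdorff_dim F <= 2%:E)%E.
Proof. exact: hausdorff_dim_le2 polygonal_fractal_sub_disk. Qed.

End polygonal_fractal_dimension.

(** * Passage to the limit *)

Lemma powR_dominated {R : realType} (s : R) : s < 2 ->
  \forall n \near \oo, (4 * n%:R) `^ s <= (n%:R / 128) ^+ 2.
Proof.
move=> s2; have u0 : 0 < 2 - s by rewrite subr_gt0.
(* As [(n / 128) ^ 2 = (4n) ^ 2 / 512 ^ 2], the claim amounts to [512 ^ 2 <= (4n) ^ (2 - s)], which
   holds beyond this threshold. *)
have h1 := nbhs_infty_ger ((512 ^+ 2) `^ (2 - s)^-1 : R).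
have h2 : \forall n \near \oo, (1 <= n)%N by exists 1%N.
apply: filterS2 h1 h2 => n n_big n1.
have n0 : 0 < n%:R :> R by rewrite ltr0n.
have -> : (n%:R / 128) ^+ 2 = (4 * n%:R) ^+ 2 / 512 ^+ 2 :> R by field.
rewrite ler_pdivlMr ?exprn_gt0//.
rewrite -(@powR_mulrn _ (4 * n%:R)) ?mulr_ge0//.
have -> : 2%:R = s + (2 - s) by ring.
rewrite powRD; last by apply/implyP => _; rewrite gt_eqF// mulr_gt0.
rewrite ler_wpM2l ?powR_ge0//.
have -> : 512 ^+ 2 = ((512 ^+ 2) `^ (2 - s)^-1) `^ (2 - s) :> R.
  by rewrite -powRrM mulVf ?gt_eqF// powRr1// exprn_ge0.
apply: ge0_ler_powR; rewrite ?nnegrE ?powR_ge0 ?mulr_ge0 ?(ltW u0)//.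
by apply: (le_trans n_big); rewrite ler_peMl// ler1n.
Qed.

Lemma polygonal_fractal_dim_cvg {R : realType} (m : nat -> nat) (l : nat)
    (theta : nat -> R) : (l <= 1)%N ->
  (forall n, (2 <= n)%N -> n%:R / 4 <= (m n)%:R :> R /\ (m n)%:R <= n%:R / 4 + 1 :> R) ->
  hausdorff_dim (polygonal_fractal n (m n) l (theta n)) @[n --> \oo] --> (2 : R)%:E.
Proof.
move=> l1 m_quarter.
have n_large : \forall n \near \oo, (128 <= n)%N by exists 128%N.
have dim_lb (s : R) : 0 <= s < 2 -> \forall n \near \oo,
    (s%:E <= hausdorff_dim (polygonal_fractal n (m n) l (theta n)) <= 2%:E)%E.
  move=> /andP[s0 s2]; apply: filterS2 n_large (powR_dominated s2) => n n128 ns.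
  have [m1 m2] := m_quarter n (leq_trans (isT : (2 <= 128)%N) n128).
  apply/andP; split; first exact: polygonal_fractal_dim_ge.
  exact: polygonal_fractal_dim_le2.
have fin_numE (s : R) x : (s%:E <= x <= 2%:E)%E -> x = (fine x)%:E.
  by case: x => //= /andP[].
apply/fine_cvgP; split.
  have : 0 <= (1 : R) < 2 by rewrite ler01/= ltr1n.
  by move/dim_lb; apply: filterS => n /fin_numE ->.
apply/cvgrPdist_le => e e0.
(* Capping [e] at 1 keeps the exponent [2 - e] nonnegative, as [dim_lb] requires. *)
have s02 : 0 <= 2 - Num.min e 1 < 2.
  have min_le1 : Num.min e 1 <= 1 by rewrite ge_min lexx orbT.
  have min_gt0 : 0 < Num.min e 1 by rewrite lt_min e0 ltr01.
  by apply/andP; split; lra.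
apply: filterS (dim_lb _ s02) => n /[dup] /fin_numE -> /=.
rewrite !lee_fin => /andP[h1 h2].
rewrite ger0_norm ?subr_ge0// lerBlDr -lerBlDl (le_trans _ h1)// lerB//.
by rewrite ge_min lexx.
Qed.

Theorem theorem4 (R : realType) (m : nat -> nat)
    (m_range : forall n : nat, (2 <= n)%N ->
       (1 <= m n)%N /\ (m n)%:R <= n%:R / 2 :> R)
    (m_quarter : forall n : nat, (2 <= n)%N ->
       n%:R / 4 <= (m n)%:R :> R /\ (m n)%:R <= n%:R / 4 + 1 :> R) :
  (hausdorff_dim (polygonal_fractal n (m n) 0 (0 : R))
     @[n --> within [set n : nat | ~~ odd n] \oo] --> (2 : R)%:E) /\
  (hausdorff_dim (polygonal_fractal n (m n) 1 (gamma_angle n (m n) 1 : R))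
     @[n --> within [set n : nat | odd n] \oo] --> (2 : R)%:E).
Proof.
(* For fixed [l] the dimension converges along all integers, hence along each parity class. *)
split; apply: cvg_trans (cvg_app _ (cvg_within _)) _.
  exact: (polygonal_fractal_dim_cvg (fun=> 0) _ m_quarter).
exact: (polygonal_fractal_dim_cvg (fun n => gamma_angle n (m n) 1) _ m_quarter).
Qed.
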